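(* Let $\mathcal D$ be a dyadic grid in $\mathbf R^d$, let $\mathcal S\subseteq\mathcal D$ be a sparse collection, and let $\alpha_1,\ldots,\alpha_m\in[0,1)$ with $\sum_{j=1}^m\alpha_j<1$. Then \[ \sum_{\substack{Q'\in\mathcal S\\ Q'\subseteq Q}}\Big(\prod_{j=1}^m\langle g_j\rangle_{1,Q'}^{\alpha_j}\Big)|Q'|\lesssim\Big(\prod_{j=1}^m\langle g_j\rangle_{1,Q}^{\alpha_j}\Big)|Q| \] for all $g_1,\ldots,g_m\in L^1_{\mathrm{loc}}(\mathbf R^d)$ and all $Q\in\mathcal D$, with implicit constant depending only on $d$, $m$ and $\alpha_1,\dots,\alpha_m$.
   Context: A dyadic grid is $\mathcal D^\alpha=\{2^{-j}([0,1)^d+\alpha+k):j\in\mathbf Z,k\in\mathbf Z^d\}$ for some $\alpha\in\{0,\frac13,\frac23\}^d$. A collection $\mathcal S$ of cubes is sparse if each $Q\in\mathcal S$ has $E_Q\subseteq Q$ with $|E_Q|\ge\frac12|Q|$ and $\{E_Q\}_{Q\in\mathcal S}$ pairwise disjoint. $\langle g\rangle_{1,Q}:=\frac1{|Q|}\int_Q|g|$. *)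

(* Defs.v *)
From HB Require Import structures.
From mathcomp Require Import all_boot all_order all_algebra.
From mathcomp Require Import all_classical all_reals all_analysis.
Import Order.TTheory GRing.Theory Num.Theory.
Local Open Scope classical_set_scope.
Local Open Scope ring_scope.

Section ProdSigmaFinite.
Local Open Scope ereal_scope.
Context d1 d2 (T1 : measurableType d1) (T2 : measurableType d2) (R : realType).
Variable m1 : {sigma_finite_measure set T1 -> \bar R}.
Variable m2 : {sigma_finite_measure set T2 -> \bar R}.

Lemma prodsf_sigma_finite : sigma_finite setT (m1 \x m2).
Proof.
have /sigma_finiteP[F [TF ndF Foo]] := sigma_finiteT m1.
have /sigma_finiteP[G [TG ndG Goo]] := sigma_finiteT m2.
exists (fun n => F n `*` G n).
 rewrite -setXTT TF TG predeqE => -[x y]; split.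
    move=> [/= [n _ Fnx] [k _ Gky]]; exists (maxn n k) => //; split.
    - by move: x Fnx; exact/subsetPset/ndF/leq_maxl.
    - by move: y Gky; exact/subsetPset/ndG/leq_maxr.
  by move=> [n _ []/= ? ?]; split; exists n.
move=> k; have [? ?] := Foo k; have [? ?] := Goo k.
split; first exact: measurableX.
by rewrite product_measure1E// lte_mul_pinfty// ge0_fin_numE.
Qed.

Definition prodsf : {sigma_finite_measure set (T1 * T2)%type -> \bar R} :=
  HB.pack (m1 \x m2)%E
    (Measure_isSigmaFinite.Build _ _ _ (m1 \x m2)%E prodsf_sigma_finite).
End ProdSigmaFinite.

(* Rsp R n is R^(n+1) = R * (R * ( ... * R)) with the product sigma-algebra
   of Borel sigma-algebras *)
Fixpoint Rsp (R : realType) (n : nat) : {dsp : measure_display & measurableType dsp} :=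
  match n with
  | 0 => existT _ _ (measurableTypeR R : measurableType _)
  | n.+1 => existT _ _ ((measurableTypeR R * projT2 (Rsp R n))%type : measurableType _)
  end.

Fixpoint lebn (R : realType) (n : nat) :
   {sigma_finite_measure set (projT2 (Rsp R n)) -> \bar R} :=
  match n return {sigma_finite_measure set (projT2 (Rsp R n)) -> \bar R} with
  | 0 => @lebesgue_measure R
  | n.+1 => @prodsf _ _ _ _ R (@lebesgue_measure R) (lebn R n)
  end.

Fixpoint box (R : realType) (n : nat) (a : nat -> R) (l : R) : set (projT2 (Rsp R n)) :=
  match n return set (projT2 (Rsp R n)) with
  | 0 => [set x : R | a 0%N <= x < a 0%N + l]
  | n.+1 => [set x : R | a 0%N <= x < a 0%N + l] `*` @box R n (fun i => a i.+1) l
  end.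
Arguments box {R} n a l.

Definition Rd (R : realType) (d : nat) := projT2 (Rsp R d.-1).
Definition leb (R : realType) (d : nat) : {sigma_finite_measure set (Rd R d) -> \bar R} :=
  lebn R d.-1.

Definition admissible_shift {R : realType} (d : nat) (shift : nat -> R) : Prop :=
  forall i, (i < d)%N -> shift i = 0 \/ shift i = 3^-1 \/ shift i = 2 / 3.

Definition dcube {R : realType} (d : nat) (shift : nat -> R) (j : int) (k : nat -> int)
  : set (Rd R d) :=
  box d.-1 (fun i => (2 : R) ^ (- j) * (shift i + (k i)%:~R)) ((2 : R) ^ (- j)).

Definition dyadic_grid {R : realType} (d : nat) (shift : nat -> R) : set (set (Rd R d)) :=
  [set Q | exists (j : int) (k : nat -> int), Q = dcube d shift j k].

Definition sparse {R : realType} (d : nat) (S : set (set (Rd R d))) : Prop :=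
  exists E : set (Rd R d) -> set (Rd R d),
    (forall Q, S Q ->
       [/\ measurable (E Q), E Q `<=` Q & ((2 : R)^-1)%:E * leb R d Q <= leb R d (E Q)]%E)
    /\ (forall Q Q', S Q -> S Q' -> Q <> Q' -> E Q `&` E Q' = set0).

Definition avg1 {R : realType} (d : nat) (g : Rd R d -> R) (Q : set (Rd R d)) : R :=
  fine (\int[leb R d]_(x in Q) (`|g x|)%:E)%E / fine (leb R d Q).

(* g in L^1_loc(R^d): (Borel) measurable and integrable on every bounded box
   [-r, r)^d *)
Definition loc_integrable {R : realType} (d : nat) (g : Rd R d -> R) : Prop :=
  measurable_fun setT g /\
  forall r : R, 0 < r -> (leb R d).-integrable (box d.-1 (fun=> - r) (2 * r)) (EFin \o g).

(* Main.v *)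
Require Import Defs.
From HB Require Import structures.
From mathcomp Require Import all_boot all_order all_algebra.
From mathcomp Require Import all_classical all_reals all_analysis.
From mathcomp Require Import lra ring measurable_realfun.
Import Order.TTheory GRing.Theory Num.Theory.
Local Open Scope classical_set_scope.
Local Open Scope ring_scope.

(* Write [y_j(P)] for the average of [g_j] on [P] divided by its average on [Q].
   Since [prod_j y_j ^ alpha_j <= 1 + sum_j y_j ^ a] with [a = sum_j alpha_j < 1],
   it suffices to bound [sum_P y(P) ^ a |P|] by [C |Q|] for a single function.
   Sparseness gives the packing bound [sum_P |P| <= 2 |Q|] for every subfamily, and
   a Vitali covering argument (the cubes meeting a largest cube lie in its triple)
   turns it into the weak-type bound [sum_{y(P) > 2^k} |P| <= 2 3^d |Q| / 2^k].
   Splitting [y ^ a] into dyadic layers, these bounds sum to a geometric series,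
   which converges because [a < 1]. *)

Section RealInequalities.
Context {R : realType}.

Lemma exists_expr2_ge (x : R) : exists N, x <= 2 ^+ N.
Proof.
have [x0|x0] := leP x 0; first by exists 0%N; rewrite expr0; lra.
exists (Num.Def.archi_bound x); apply: le_trans (ltW (archi_boundP (ltW x0))) _.
by rewrite -natrX ler_nat ltnW // ltn_expl.
Qed.

Lemma ltr1_powR (x p : R) : 1 < x -> p < 1 -> x `^ p < x.
Proof.
move=> x1 p1; have x0 : 0 < x by lra.
rewrite /powR gt_eqF // -{2}(lnK x0) ltr_expR.
by have := ln_gt0 x1; nra.
Qed.

(* When [z = 0] both sides are [0 `^ p], because [0 / 0 = 0]. *)
Lemma powR_div_mul (x z p : R) : 0 <= x -> 0 <= z -> (z = 0 -> x = 0) ->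
  x `^ p = (x / z) `^ p * z `^ p.
Proof.
move=> x0 z0 zx; have [z00|zn0] := eqVneq z 0.
  rewrite z00 (zx z00) mul0r; have [->|p0] := eqVneq p 0; first by rewrite powRr0 mulr1.
  by rewrite powR0 // mul0r.
by rewrite -powRM ?divfK // divr_ge0.
Qed.

Lemma powR_le_dyadic_layers (a r : R) N : 0 <= a -> 0 <= r -> r <= 2 ^+ N ->
  r `^ a <= 1 + \sum_(k < N) (2 `^ a) ^+ k.+1 * ((2 ^+ k < r)%R)%:R.
Proof.
move=> a0 r0; elim: N => [|N IH] rN.
  rewrite big_ord0 addr0; apply: le_trans (ge0_ler_powR a0 _ _ rN) _;
  by rewrite ?nnegrE // expr0 powR1.
rewrite big_ord_recr /= addrA.
have [r_le|r_gt] := leP r (2 ^+ N); first by rewrite mulr0 addr0; exact: IH.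
rewrite mulr1 -powR_mulrn // -powRrM mulrC powRrM powR_mulrn //.
apply: le_trans (ge0_ler_powR a0 _ _ rN) _; rewrite ?nnegrE ?exprn_ge0 //.
by rewrite lerDr addr_ge0 ?sumr_ge0.
Qed.

Lemma prod_powR_le_sum (m : nat) (y alpha : 'I_m -> R) :
  (forall j, 0 <= y j) -> (forall j, 0 <= alpha j) ->
  \prod_(j < m) y j `^ alpha j <= 1 + \sum_(j < m) y j `^ (\sum_(j < m) alpha j).
Proof.
move=> y0 alpha0; set a := \sum_j alpha j.
pose M : R := \big[Num.max/1]_(j < m) y j.
have M1 : 1 <= M by rewrite /M; elim/big_rec: _ => // j x _ x1; rewrite le_max x1 orbT.
have yM j : y j <= M by exact: le_bigmax.
apply: (@le_trans _ _ (M `^ a)).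
  have -> : M `^ a = \prod_(j < m) M `^ alpha j.
    have M0 : M != 0 by rewrite gt_eqF // (lt_le_trans ltr01 M1).
    by apply: (big_morph (powR M) _ (powRr0 M)) => p q; rewrite powRD // M0 implybT.
  apply: ler_prod => j _; rewrite powR_ge0 ge0_ler_powR ?nnegrE //; lra.
have [->|[j ->]] : M = 1 \/ exists j, M = y j.
  rewrite /M; elim/big_rec: _ => [|j x _ Mx]; first by left.
  by rewrite maxElt; case: ifP => _; [|right; exists j].
- by rewrite powR1 lerDl sumr_ge0 // => j _; exact: powR_ge0.
- by rewrite (bigD1 j) //= addrCA lerDl addr_ge0 ?sumr_ge0 // => i _; exact: powR_ge0.
Qed.

Lemma sum_powR_le_layers (I : eqType) (s : seq I) (r V : I -> R) (a A B : R) :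
  0 <= a < 1 -> (forall i, 0 <= r i) -> (forall i, 0 <= V i) ->
  \sum_(i <- s) V i <= A ->
  (forall k, \sum_(i <- s | 2 ^+ k < r i) V i <= B / 2 ^+ k) ->
  \sum_(i <- s) r i `^ a * V i <= A + B * (2 `^ a / (1 - 2 `^ a / 2)).
Proof.
move=> /andP[a0 a1] r0 V0 sumA level; set q := 2 `^ a.
have q0 : 0 < q by rewrite powR_gt0.
have q2 : q < 2 by apply: ltr1_powR; lra.
have B0 : 0 <= B.
  by have := level 0%N; rewrite expr0 divr1; apply: le_trans; rewrite sumr_ge0.
have [N maxN] := exists_expr2_ge (\big[Num.max/0]_(i <- s) r i).
have layers i : i \in s -> r i `^ a * V i <=
    V i + \sum_(k < N) q ^+ k.+1 * (((2 ^+ k < r i)%R)%:R * V i).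
  move=> si; under eq_bigr do rewrite mulrA.
  rewrite -big_distrl -[X in _ <= X + _]mul1r -mulrDl.
  apply: ler_wpM2r => //; apply: powR_le_dyadic_layers => //.
  exact: le_trans (le_bigmax_seq _ _ _ _ si isT) maxN.
rewrite big_seq; apply: le_trans (ler_sum _ layers) _; rewrite -big_seq.
rewrite big_split /= exchange_big /=; apply: lerD => //.
apply: (@le_trans _ _ (\sum_(k < N) q ^+ k.+1 * (B / 2 ^+ k))).
  apply: ler_sum => k _; rewrite -big_distrr /=.
  apply: ler_wpM2l; first by rewrite exprn_ge0 // ltW.
  apply: le_trans (level k); rewrite [leRHS]big_mkcond; apply: ler_sum => i _.
  by case: (_ < _); rewrite ?mul1r ?mul0r.
have -> : \sum_(k < N) q ^+ k.+1 * (B / 2 ^+ k) = B * (q * \sum_(k < N) (q / 2) ^+ k).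
  rewrite [RHS]mulrA [RHS]big_distrr; apply: eq_bigr => k _ /=.
  by rewrite exprS expr_div_n; field; rewrite expf_neq0.
apply: ler_wpM2l => //; apply: ler_wpM2l; first exact: ltW.
rewrite -[leRHS]mul1r; apply: le_trans (geometric_le_lim N ler01 _ _).
- by rewrite /series /= big_mkord; apply: ler_sum => k _; rewrite mul1r.
- by rewrite divr_gt0.
- by rewrite ger0_norm ?ltr_pdivrMr ?mul1r ?divr_ge0 // ltW.
Qed.

End RealInequalities.

Lemma exists_seq_argmax {dX} {X : orderType dX} {I : eqType} (F : I -> X) (s : seq I) :
  s != [::] -> exists2 i, i \in s & forall j, j \in s -> (F j <= F i)%O.
Proof.
case: s => [//|x s] _; pose M := \big[Order.max/F x]_(j <- x :: s) F j.
have [i xsi Mi] : exists2 i, i \in x :: s & M = F i.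
  rewrite /M big_seq; elim/big_rec: _ => [|j y xsj [i xsi ->]].
    by exists x; rewrite ?mem_head.
  by rewrite maxElt; case: ifP => _; [exists i | exists j].
by exists i => // j xsj; rewrite -Mi; exact: le_bigmax_seq.
Qed.

Lemma esum_le_seq {R : realType} {I : choiceType} (A : set I) (F : I -> \bar R) (B : \bar R) :
  (forall s : seq I, uniq s -> (forall i, i \in s -> A i) -> (\sum_(i <- s) F i <= B)%E) ->
  (\esum_(i in A) F i <= B)%E.
Proof.
move=> sB; apply: ub_ereal_sup => _ [X [finX XA] <-].
rewrite fsbig_finite //=; apply: sB; first exact: finmap.fset_uniq.
by move=> i; rewrite in_fset_set // inE => /XA.
Qed.

Section SparseFamily.
Context {d} {T : measurableType d} {R : realType} (mu : {measure set T -> \bar R}).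
Local Open Scope ereal_scope.

Definition sparse_family (E : set T -> set T) (s : seq (set T)) : Prop :=
  (forall P, P \in s ->
    [/\ measurable (E P), E P `<=` P & (2^-1)%:E * mu P <= mu (E P)]) /\
  trivIset [set` s] E.

Lemma sparse_family_sub E (s s' : seq (set T)) :
  {subset s' <= s} -> sparse_family E s -> sparse_family E s'.
Proof.
move=> s's [sE triv]; split => [P /s's/sE //|].
by apply: sub_trivIset triv => P /s's.
Qed.

Lemma sparse_family_sum_le E (s : seq (set T)) (A : set T) : measurable A -> uniq s ->
  (forall P, P \in s -> P `<=` A) -> sparse_family E s ->
  \sum_(P <- s) mu P <= 2%:E * mu A.
Proof.
move=> mA us sA [sE triv].
have mE P : P \in s -> measurable (E P) by case/sE.
apply: (@le_trans _ _ (\sum_(P <- s) 2%:E * mu (E P))).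
  rewrite big_seq [leRHS]big_seq; apply: lee_sum => P /sE[_ _ half].
  by rewrite -lee_pdivrMl // -EFinV.
rewrite -ge0_sume_distrr; last by move=> P _; exact: measure_ge0.
apply: lee_wpmul2l => //.
rewrite fsbig_seq // -measure_fsbig ?finite_seq //.
rewrite fsbig_setU ?finite_seq // bigcup_seq; apply: le_measure; rewrite ?inE //.
  by rewrite big_seq; apply: bigsetU_measurable => P /mE.
move=> x; rewrite -bigcup_seq => -[P /= Ps EPx].
by have [_ EPP _] := sE P Ps; exact: sA P Ps x (EPP x EPx).
Qed.

End SparseFamily.

Section AbsIntegral.
Context {d} {T : measurableType d} {R : realType} (mu : {measure set T -> \bar R}).
Local Open Scope ereal_scope.

Lemma integral_abs_subset_fin (g : T -> R) (A B : set T) :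
  measurable_fun setT g -> measurable A -> measurable B -> B `<=` A ->
  \int[mu]_(x in A) (`|g x|)%:E < +oo ->
  \int[mu]_(x in B) (`|g x|)%:E = (fine (\int[mu]_(x in B) (`|g x|)%:E))%:E /\
  (fine (\int[mu]_(x in B) (`|g x|)%:E) <= fine (\int[mu]_(x in A) (`|g x|)%:E))%R.
Proof.
move=> mg mA mB BA Afin.
have absg0 x : 0 <= (`|g x|)%:E by rewrite lee_fin.
have BleA : \int[mu]_(x in B) (`|g x|)%:E <= \int[mu]_(x in A) (`|g x|)%:E.
  apply: ge0_subset_integral => //; apply/measurable_EFinP.
  exact/measurableT_comp/measurable_funTS.
have Bfin : \int[mu]_(x in B) (`|g x|)%:E \is a fin_num.
  by rewrite ge0_fin_numE ?integral_ge0 // (le_lt_trans BleA).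
have Afin' : \int[mu]_(x in A) (`|g x|)%:E \is a fin_num.
  by rewrite ge0_fin_numE ?integral_ge0.
by split; [rewrite fineK | rewrite -lee_fin !fineK].
Qed.

End AbsIntegral.

Section Boxes.
Context {R : realType}.

Let interval_co (a l : R) : [set x : R | a <= x < a + l] = [set` `[a, a + l[%R].
Proof. by apply/seteqP; split => x /=; rewrite in_itv. Qed.

Let interval_co_measurable (a l : R) : measurable [set x : R | a <= x < a + l].
Proof. by rewrite interval_co; exact: measurable_itv. Qed.

Lemma box_measurable n (a : nat -> R) l : measurable (box n a l).
Proof.
elim: n a => [|n IH] a /=; first exact: interval_co_measurable.
by apply: measurableX; [exact: interval_co_measurable | exact: IH].
Qed.

Lemma lebn_box n (a : nat -> R) l : 0 <= l -> lebn R n (box n a l) = (l ^+ n.+1)%:E.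
Proof.
move=> l0; have interval_measure b :
    lebesgue_measure [set x : R | b <= x < b + l] = l%:E.
  rewrite interval_co lebesgue_measure_itv /= lte_fin ltrDl.
  have [l_gt0|l_le0] := ltP 0 l; first by rewrite -EFinB addrAC subrr add0r.
  by have -> : l = 0 by lra.
elim: n a => [|n IH] a /=; first by rewrite interval_measure expr1.
rewrite product_measure1E; [|exact: interval_co_measurable|exact: box_measurable].
by rewrite IH -[X in (X * _)%E]/(lebesgue_measure _) interval_measure -EFinM -exprS.
Qed.

Lemma box_nonempty n (a : nat -> R) l : 0 < l -> box n a l !=set0.
Proof.
move=> l0; elim: n a => [|n IH] a /=; first by exists (a 0%N); rewrite /= lexx /=; lra.
by have [x bx] := IH (fun i => a i.+1); exists (a 0%N, x); split => //=; rewrite lexx /=; lra.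
Qed.

Lemma box_subset n (a b : nat -> R) l t :
  (forall i, (i <= n)%N -> b i <= a i /\ a i + l <= b i + t) ->
  box n a l `<=` box n b t.
Proof.
elim: n a b => [|n IH] a b /= ab.
  by move=> x /andP[? ?]; have [? ?] := ab 0%N isT; apply/andP; split; lra.
move=> [x y] [/= /andP[? ?] ?]; split => /=.
  by have [? ?] := ab 0%N isT; apply/andP; split; lra.
by apply: (IH (fun i => a i.+1) (fun i => b i.+1)) => // i ?; apply: ab.
Qed.

Lemma box_sub_dilate n (a b : nat -> R) l t : 0 <= t <= l ->
  box n a l `&` box n b t !=set0 -> box n b t `<=` box n (fun i => a i - l) (3 * l).
Proof.
move=> /andP[t0 tl]; elim: n a b => [|n IH] a b /=.
  move=> [x [/andP[? ?] /andP[? ?]]] y /andP[? ?]; apply/andP; split; lra.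
move=> [[x1 x2] [[/= /andP[? ?] ?] [/= /andP[? ?] ?]]] [y1 y2] [/= /andP[? ?] ?].
split => /=; first by apply/andP; split; lra.
by apply: (IH (fun i => a i.+1) (fun i => b i.+1)) => //; exists x2.
Qed.

End Boxes.

Definition is_cube {R : realType} n (P : set (projT2 (Rsp R n))) : Prop :=
  exists (a : nat -> R) (l : R), 0 < l /\ P = box n a l.

Section Cubes.
Context {R : realType} {n : nat}.
Local Notation T := (projT2 (Rsp R n)).
Local Notation mu := (lebn R n).

Lemma cube_measurable (P : set T) : is_cube n P -> measurable P.
Proof. by move=> [a [l [_ ->]]]; exact: box_measurable. Qed.

Lemma cube_measureE (P : set T) : is_cube n P -> mu P = (fine (mu P))%:E.
Proof. by move=> [a [l [l0 ->]]]; rewrite lebn_box ?ltW. Qed.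

Lemma cube_measure_gt0 (P : set T) : is_cube n P -> 0 < fine (mu P).
Proof. by move=> [a [l [l0 ->]]]; rewrite lebn_box ?ltW //= exprn_gt0. Qed.

Lemma sum_cube_measureE (s : seq (set T)) : (forall P, P \in s -> is_cube n P) ->
  (\sum_(P <- s) mu P = (\sum_(P <- s) fine (mu P))%:E)%E.
Proof.
by move=> scube; rewrite -sumEFin; apply: eq_big_seq => P /scube/cube_measureE.
Qed.

Lemma cube_sub_dilate (P : set T) (a : nat -> R) l : 0 < l -> is_cube n P ->
  (mu P <= mu (box n a l))%E -> P `&` box n a l !=set0 ->
  P `<=` box n (fun i => a i - l) (3 * l).
Proof.
move=> l0 [b [t [t0 ->]]]; rewrite !lebn_box ?(ltW t0) ?(ltW l0) // lee_fin.
rewrite ler_pXn2r ?nnegrE ?(ltW t0) ?(ltW l0) //.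
by move=> tl; rewrite setIC; apply: box_sub_dilate; rewrite ltW.
Qed.

Lemma dyadic_grid_cube (shift : nat -> R) (P : set T) :
  dyadic_grid n.+1 shift P -> is_cube n P.
Proof.
move=> [j [k ->]]; exists (fun i => 2 ^ (- j) * (shift i + (k i)%:~R)), (2 ^ (- j)).
by rewrite exprz_gt0.
Qed.

End Cubes.

Section Vitali.
Context {R : realType} {n : nat}.
Local Notation T := (projT2 (Rsp R n)).
Local Notation mu := (lebn R n).
Variables (E : set T -> set T) (f : T -> R).
Hypotheses (mf : measurable_fun setT f) (f0 : forall x, 0 <= f x).
Local Open Scope ereal_scope.

Lemma sum_meeting_largest_le (lam : R) (s : seq (set T)) (a : nat -> R) l :
  (0 < lam)%R -> (0 < l)%R -> uniq s ->
  (forall P, P \in s -> is_cube n P /\ mu P <= mu (box n a l)) -> sparse_family mu E s ->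
  lam%:E * mu (box n a l) <= \int[mu]_(x in box n a l) (f x)%:E ->
  \sum_(P <- s | `[< P `&` box n a l !=set0 >]) mu P <=
    (2 * 3 ^+ n.+1 / lam)%:E * \int[mu]_(x in box n a l) (f x)%:E.
Proof.
move=> lam0 l0 us sP sE lam_avg; rewrite -big_filter.
apply: le_trans (sparse_family_sum_le mu E _ (box n (fun i => a i - l)%R (3 * l)%R) _ _ _ _) _.
- exact: box_measurable.
- exact: filter_uniq.
- move=> P; rewrite mem_filter => /andP[/asboolP meet /sP[Pcube PP0]].
  exact: cube_sub_dilate.
- by apply: sparse_family_sub sE => P; rewrite mem_filter => /andP[].
apply: le_trans (lee_wpmul2l _ lam_avg); last by rewrite lee_fin divr_ge0 // ltW.
have l30 : (0 <= 3 * l)%R by rewrite mulr_ge0 // ltW.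
have l00 := ltW l0.
rewrite -[X in 2 * X]/(mu (box n _ _)) !lebn_box // -!EFinM lee_fin exprMn.
by rewrite !mulrA divfK ?gt_eqF.
Qed.

(* Induction on the family: the cubes meeting a largest cube [P0] are handled by
   [sum_meeting_largest_le], the others lie in [A `\` P0]. *)
Lemma vitali_sparse_sum_le (lam : R) (A : set T) (s : seq (set T)) :
  (0 < lam)%R -> measurable A -> uniq s ->
  (forall P, P \in s -> is_cube n P /\ P `<=` A) -> sparse_family mu E s ->
  (forall P, P \in s -> lam%:E * mu P <= \int[mu]_(x in P) (f x)%:E) ->
  \sum_(P <- s) mu P <= (2 * 3 ^+ n.+1 / lam)%:E * \int[mu]_(x in A) (f x)%:E.
Proof.
move=> lam0; have [N] := ubnP (size s); elim: N => // N IH in A s *.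
rewrite ltnS => sN mA us sA sE s_avg.
have c0 : 0 <= (2 * 3 ^+ n.+1 / lam)%:E by rewrite lee_fin divr_ge0 // ltW.
have [->|s0] := eqVneq s [::].
  by rewrite big_nil mule_ge0 // integral_ge0 // => x _; rewrite lee_fin.
have [P0 P0s P0max] := exists_seq_argmax (fun P : set T => mu P) _ s0.
have [[a [l [l0 P0E]]] P0A] := sA P0 P0s; subst P0.
set P0 := box n a l in P0s P0max P0A *.
have mP0 : measurable P0 by exact: box_measurable.
pose meets P := `[< P `&` P0 !=set0 >].
have -> : \int[mu]_(x in A) (f x)%:E =
    \int[mu]_(x in P0) (f x)%:E + \int[mu]_(x in A `\` P0) (f x)%:E.
  rewrite -{1}(setDUK P0A) ge0_integral_setU //; first exact: measurableD.
  - exact/measurable_EFinP/measurable_funTS.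
  - by move=> x _; rewrite lee_fin.
  - by rewrite disj_set2E setDIK.
rewrite (bigID meets) /= -[X in _ + X]big_filter ge0_muleDr;
  try by apply: integral_ge0 => x _; rewrite lee_fin.
apply: leeD.
  apply: sum_meeting_largest_le => //; last exact: s_avg.
  by move=> P Ps; split; [exact: (sA P Ps).1 | exact: P0max].
apply: IH.
- rewrite size_filter; apply: leq_trans sN.
  rewrite -(count_predC meets s) -[X in (X < _)%N]add0n ltn_add2r -has_count.
  by apply/hasP; exists P0 => //; apply/asboolP; rewrite setIid; exact: box_nonempty.
- exact: measurableD.
- exact: filter_uniq.
- move=> P; rewrite mem_filter => /andP[/asboolPn disj /sA[Pcube PA]].
  by split => // x Px; split; [exact: PA | move=> P0x; apply: disj; exists x].
- by apply: sparse_family_sub sE => P; rewrite mem_filter => /andP[].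
- by move=> P; rewrite mem_filter => /andP[_ /s_avg].
Qed.

End Vitali.

(* [2] is the packing constant of a sparse family, [2 * 3 ^+ n.+1] the Vitali
   constant of the level sets and [2 `^ a / (1 - 2 `^ a / 2)] the sum of the
   dyadic layers of [r `^ a]. *)
Definition sparse_const {R : realType} (n : nat) (a : R) : R :=
  2 + 2 * 3 ^+ n.+1 * (2 `^ a / (1 - 2 `^ a / 2)).

Lemma sparse_const_ge2 {R : realType} n (a : R) : a < 1 -> 2 <= sparse_const n a.
Proof.
move=> a1; have q2 : 2 `^ a < 2 :> R by apply: ltr1_powR; rewrite ?ltr1n.
rewrite /sparse_const lerDl !mulr_ge0 ?exprn_ge0 ?powR_ge0 // invr_ge0 subr_ge0.
by rewrite ler_pdivrMr // mul1r ltW.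
Qed.

Lemma avg1_ge0 {R : realType} d (g : Rd R d -> R) (P : set (Rd R d)) : 0 <= avg1 d g P.
Proof. by rewrite divr_ge0 ?fine_ge0 ?measure_ge0 ?integral_ge0. Qed.

Section SparseInCube.
Context {R : realType} {n : nat}.
Local Notation T := (projT2 (Rsp R n)).
Local Notation mu := (lebn R n).
Local Notation avg := (avg1 n.+1).
Context {Q : set T} {s : seq (set T)} {E : set T -> set T}.
Hypotheses (Qcube : is_cube n Q) (us : uniq s)
  (s_sub : forall P, P \in s -> is_cube n P /\ P `<=` Q) (sE : sparse_family mu E s).

Let mQ : measurable Q := cube_measurable _ Qcube.
Let s_cube (P : set T) : P \in s -> is_cube n P. Proof. by case/s_sub. Qed.

Lemma sum_cube_measure_le : \sum_(P <- s) fine (mu P) <= 2 * fine (mu Q).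
Proof.
have := sparse_family_sum_le mu E s Q mQ us (fun P Ps => (s_sub P Ps).2) sE.
rewrite sum_cube_measureE // => h.
rewrite -lee_fin EFinM -(cube_measureE _ Qcube); exact: h.
Qed.

Section OneFunction.
Variable g : T -> R.
Hypotheses (mg : measurable_fun setT g) (gQ : (\int[mu]_(x in Q) (`|g x|)%:E < +oo)%E).

Let integral_cubeE (P : set T) : P \in s ->
  (\int[mu]_(x in P) (`|g x|)%:E = (fine (\int[mu]_(x in P) (`|g x|)%:E))%:E)%E /\
  fine (\int[mu]_(x in P) (`|g x|)%:E) <= fine (\int[mu]_(x in Q) (`|g x|)%:E).
Proof.
move=> Ps; apply: integral_abs_subset_fin => //; last exact: (s_sub P Ps).2.
exact/cube_measurable/s_cube.
Qed.

Lemma avg_sub_eq0 (P : set T) : P \in s -> avg g Q = 0 -> avg g P = 0.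
Proof.
move=> Ps; have VQ0 := cube_measure_gt0 _ Qcube.
rewrite /avg1 /leb /= => /eqP; rewrite mulf_eq0 invr_eq0 (gt_eqF VQ0) orbF => /eqP IQ0.
have [_] := integral_cubeE P Ps; rewrite IQ0 => IP0.
rewrite /avg1 (_ : fine _ = 0) ?mul0r //; apply/eqP.
by rewrite eq_le IP0 fine_ge0 // integral_ge0 // => x _; rewrite lee_fin.
Qed.

Lemma sum_cube_measure_level_le k :
  \sum_(P <- s | 2 ^+ k < avg g P / avg g Q) fine (mu P) <=
    2 * 3 ^+ n.+1 * fine (mu Q) / 2 ^+ k.
Proof.
have VQ0 := cube_measure_gt0 _ Qcube.
have rhs0 : 0 <= 2 * 3 ^+ n.+1 * fine (mu Q) / 2 ^+ k.
  by rewrite !mulr_ge0 ?exprn_ge0 ?invr_ge0 ?exprn_ge0 ?ltW.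
have [AQ0|AQ0] := eqVneq (avg g Q) 0.
  (* the quotients are [x / 0 = 0], so no cube lies in the level set *)
  by rewrite big1 // => P; rewrite AQ0 invr0 mulr0 ltNge exprn_ge0.
have lam0 : 0 < 2 ^+ k * avg g Q by rewrite mulr_gt0 ?exprn_gt0 // lt0r AQ0 avg1_ge0.
have [IQE _] := integral_abs_subset_fin mu _ _ _ mg mQ mQ (@subset_refl _ Q) gQ.
set sk := [seq P <- s | 2 ^+ k < avg g P / avg g Q]; rewrite -big_filter.
have sk_s : {subset sk <= s} by move=> P; rewrite mem_filter => /andP[].
have lam_avg (P : set T) : P \in sk ->
    ((2 ^+ k * avg g Q)%:E * mu P <= \int[mu]_(x in P) (`|g x|)%:E)%E.
  rewrite mem_filter => /andP[lt Ps]; have [-> _] := integral_cubeE P Ps.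
  rewrite (cube_measureE _ (s_cube P Ps)) -EFinM lee_fin ltW //.
  have AQ_gt0 : 0 < avg g Q by rewrite lt0r AQ0 avg1_ge0.
  move: lt; rewrite ltr_pdivlMr // {2}/avg1 ltr_pdivlMr //.
  exact: cube_measure_gt0 (s_cube P Ps).
have m_absg : measurable_fun setT (fun x => `|g x|) by exact: measurableT_comp.
have := vitali_sparse_sum_le E (fun x => `|g x|) m_absg (fun x => normr_ge0 (g x))
  _ Q sk lam0 mQ (filter_uniq _ us) (fun P Psk => s_sub P (sk_s P Psk))
  (sparse_family_sub _ _ _ _ sk_s sE) lam_avg.
rewrite sum_cube_measureE => [|P /sk_s/s_cube //].
rewrite IQE -EFinM lee_fin => /le_trans; apply.
have IQ0 : fine (\int[mu]_(x in Q) (`|g x|)%:E) != 0.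
  by apply: contraNneq AQ0; rewrite /avg1 => ->; rewrite mul0r.
rewrite [leLHS](_ : _ = 2 * 3 ^+ n.+1 * fine (mu Q) / 2 ^+ k) // /avg1 /=.
by field; rewrite IQ0 expf_neq0 ?gt_eqF.
Qed.

Lemma sum_avg_powR_le (a : R) : 0 <= a < 1 ->
  \sum_(P <- s) (avg g P / avg g Q) `^ a * fine (mu P) <= sparse_const n a * fine (mu Q).
Proof.
move=> a01; have r0 P : 0 <= avg g P / avg g Q by rewrite divr_ge0 ?avg1_ge0.
have V0 (P : set T) : 0 <= fine (mu P) by rewrite fine_ge0 ?measure_ge0.
apply: le_trans (sum_powR_le_layers _ _ _ _ _ _ _ a01 r0 V0 sum_cube_measure_le
  sum_cube_measure_level_le) _.
by rewrite /sparse_const le_eqVlt; apply/orP; left; apply/eqP; ring.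
Qed.

End OneFunction.

Lemma sum_prod_avg_le m (g : 'I_m -> T -> R) (alpha : 'I_m -> R) :
  (forall j, measurable_fun setT (g j)) ->
  (forall j, (\int[mu]_(x in Q) (`|g j x|)%:E < +oo)%E) ->
  (forall j, 0 <= alpha j) -> \sum_(j < m) alpha j < 1 ->
  \sum_(P <- s) (\prod_(j < m) avg (g j) P `^ alpha j) * fine (mu P) <=
    (m.+1)%:R * sparse_const n (\sum_(j < m) alpha j) *
      ((\prod_(j < m) avg (g j) Q `^ alpha j) * fine (mu Q)).
Proof.
move=> mg gQ alpha0 alpha1; set a := \sum_(j < m) alpha j.
set PQ := \prod_(j < m) avg (g j) Q `^ alpha j; set VQ := fine (mu Q).
pose r j P := avg (g j) P / avg (g j) Q.
have a01 : 0 <= a < 1 by rewrite alpha1 sumr_ge0.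
have PQ0 : 0 <= PQ by rewrite prodr_ge0 // => j _; exact: powR_ge0.
have VQ0 : 0 <= VQ := ltW (cube_measure_gt0 _ Qcube).
have K2 := sparse_const_ge2 n _ alpha1.
have split_avg (P : set T) : P \in s ->
    \prod_(j < m) avg (g j) P `^ alpha j = (\prod_(j < m) r j P `^ alpha j) * PQ.
  move=> Ps; rewrite -big_split /=; apply: eq_bigr => j _.
  by apply: powR_div_mul; rewrite ?avg1_ge0 //; exact: avg_sub_eq0.
apply: (@le_trans _ _ (PQ * (\sum_(P <- s) fine (mu P) +
    \sum_(j < m) \sum_(P <- s) r j P `^ a * fine (mu P)))).
  rewrite exchange_big -big_split /= mulr_sumr big_seq [leRHS]big_seq.
  apply: ler_sum => P Ps; rewrite split_avg // mulrAC mulrC ler_wpM2l //.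
  rewrite -big_distrl -{2}[fine (mu P)]mul1r -mulrDl ler_wpM2r ?fine_ge0 ?measure_ge0 //.
  by apply: prod_powR_le_sum => // j; rewrite divr_ge0 ?avg1_ge0.
apply: (@le_trans _ _ (PQ * (2 * VQ + m%:R * (sparse_const n a * VQ)))).
  apply: ler_wpM2l => //; apply: lerD; first exact: sum_cube_measure_le.
  rewrite mulr_natl -[X in _ *+ X]card_ord -sumr_const.
  by apply: ler_sum => j _; exact: sum_avg_powR_le.
have K2' : 0 <= sparse_const n a - 2 by rewrite subr_ge0.
have := mulr_ge0 (mulr_ge0 PQ0 VQ0) K2'.
by rewrite -addn1 natrD; lra.
Qed.

End SparseInCube.

Lemma loc_integrable_cube_fin {R : realType} n (g : Rd R n.+1 -> R)
    (P : set (projT2 (Rsp R n))) :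
  loc_integrable n.+1 g -> is_cube n P -> (\int[lebn R n]_(x in P) (`|g x|)%:E < +oo)%E.
Proof.
move=> [_ g_int] [a [l [l0 ->]]]; set M := \big[Num.max/0]_(i < n.+1) `|a i|.
have M0 : 0 <= M by rewrite /M; elim/big_rec: _ => // j x _ x0; rewrite le_max x0 orbT.
have r0 : 0 < M + l + 1 by lra.
have sub : box n a l `<=` box n (fun=> - (M + l + 1)) (2 * (M + l + 1)).
  apply: box_subset => i i_le_n.
  have := le_bigmax 0 (fun i : 'I_n.+1 => `|a i|) (@Ordinal n.+1 i i_le_n).
  rewrite -/M /= => aiM; have := ler_norm (a i); have := ler_norm (- a i).
  by rewrite normrN => ? ?; split; lra.
have := integrableS (box_measurable _ _ _) (box_measurable _ _ _) sub (g_int _ r0).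
by case/integrableP.
Qed.

Theorem lemma3p2 (R : realType) (d m : nat) (alpha : 'I_m -> R) :
  (0 < d)%N ->
  (forall j, 0 <= alpha j < 1) ->
  \sum_(j < m) alpha j < 1 ->
  exists C : R, 0 < C /\
    forall (shift : nat -> R), admissible_shift d shift ->
    forall S : set (set (Rd R d)), S `<=` dyadic_grid d shift -> sparse d S ->
    forall g : 'I_m -> Rd R d -> R, (forall j, loc_integrable d (g j)) ->
    forall Q : set (Rd R d), dyadic_grid d shift Q ->
      (\esum_(Q' in [set Q' | S Q' /\ Q' `<=` Q])
          ((\prod_(j < m) avg1 d (g j) Q' `^ alpha j) * fine (leb R d Q'))%:E
        <= (C * ((\prod_(j < m) avg1 d (g j) Q `^ alpha j) * fine (leb R d Q)))%:E)%E.
Proof.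
move=> d_gt0 alpha01 alpha1.
have alpha0 j : 0 <= alpha j by case/andP: (alpha01 j).
exists ((m.+1)%:R * sparse_const d.-1 (\sum_(j < m) alpha j)); split.
  by rewrite mulr_gt0 ?ltr0n // (lt_le_trans _ (sparse_const_ge2 _ _ alpha1)).
case: d d_gt0 => // n _ shift _ S S_grid [E [SE S_disj]] g g_loc Q Q_grid.
apply: esum_le_seq => s us sS; rewrite sumEFin lee_fin.
have Qcube := dyadic_grid_cube _ _ Q_grid.
apply: (sum_prod_avg_le (E := E) Qcube us) => //.
- by move=> P /sS[/S_grid/dyadic_grid_cube].
- split => [P /sS[/SE ? _] //|P P' /sS[SP _] /sS[SP' _] [x EPx]].
  by apply: contrapT => PP'; move: EPx; rewrite (S_disj P P').
- by move=> j; case: (g_loc j).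
- by move=> j; exact: loc_integrable_cube_fin.
Qed.
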